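(* Let $R$ be a real closed field and $F$ a formally real extension field of $R$. Let $P_1$ and $P_2$ be orderings of $F$ which induce the same $\mathbb R$-place of $F$, and let $R'_1$ and $R'_2$ be the real closures of $(F,P_1)$ and $(F,P_2)$ respectively. For $i=1,2$ let $\iota'_i:M(R(y))\to M(R'_i(y))$ be the (unique) continuous injective map compatible with restriction, and let $\mathrm{res}_i:M(R'_i(y))\to M(F(y))$ be the restriction map. Then $\mathrm{res}_1\circ\iota'_1=\mathrm{res}_2\circ\iota'_2$.
   Context: For a field $K$, $M(K)$ is the set of $\mathbb R$-places $K\to\mathbb R\cup\{\infty\}$, with topology generated by the subbasis $H'(b)=\{\zeta\in M(K)\mid \infty\ne\zeta(b)>0\}$, $b\in K$. Each ordering of $K$ induces an $\mathbb R$-place of $K$ (its associated place). For a field extension $L|K$, restriction is $\zeta\mapsto\zeta|_K$, and a map $\iota:M(K)\to M(L)$ is compatible with restriction if composing it with restriction gives the identity. $R(y)$, $R'_i(y)$, $F(y)$ are rational function fields in one variable $y$. The statement presupposes that the embeddings $\iota'_i$ exist (this holds iff the value group of $R$ is convex in that of $R'_i$ under the canonical valuations; in that case the embedding is unique since $R'_i$ is real closed). *)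

(* Defs.v *)
From HB Require Import structures.
From mathcomp Require Import all_boot all_order all_algebra.
From mathcomp Require Import Rstruct.
From Stdlib Require Import Rdefinitions.
Set Implicit Arguments. Unset Strict Implicit. Unset Printing Implicit Defensive.
Import Order.TTheory GRing.Theory Num.Theory.
Local Open Scope ring_scope.

(* ℝ ∪ {∞} is modelled as [option R]: [Some a] is the real a, [None] is ∞. *)
Notation RR := Rdefinitions.R.

(* An ℝ-place of K: a map ζ : K -> ℝ ∪ {∞} whose finite locus O is a
   subring on which ζ is a ring homomorphism to ℝ, and such that for x ≠ 0,
   ζ x = ∞ iff ζ (x^-1) = 0 (so O is a valuation ring and ker ζ|O is its
   maximal ideal). *)
Definition is_Rplace (K : fieldType) (z : K -> option RR) : Prop :=
  [/\ z 1 = Some 1,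
      (forall x a, z x = Some a -> z (- x) = Some (- a)),
      (forall x y a b, z x = Some a -> z y = Some b ->
          z (x + y) = Some (a + b) /\ z (x * y) = Some (a * b))
    & (forall x, x != 0 -> (z x = None <-> z x^-1 = Some 0))].

Definition M (K : fieldType) := {z : K -> option RR | is_Rplace z}.

Definition Hp (K : fieldType) (b : K) : M K -> Prop :=
  fun zeta => exists a : RR, sval zeta b = Some a /\ 0 < a.

Definition Mopen (K : fieldType) (U : M K -> Prop) : Prop :=
  forall zeta, U zeta ->
    exists s : seq K, (forall b, b \in s -> Hp b zeta) /\
      (forall xi, (forall b, b \in s -> Hp b xi) -> U xi).

Definition Mcontinuous (K L : fieldType) (f : M K -> M L) : Prop :=
  forall U : M L -> Prop, Mopen U -> Mopen (fun zeta => U (f zeta)).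

Definition is_ordering (F : fieldType) (P : F -> Prop) : Prop :=
  [/\ (forall x y, P x -> P y -> P (x + y)),
      (forall x y, P x -> P y -> P (x * y)),
      (forall x, P x \/ P (- x))
    & (forall x, P x -> P (- x) -> x = 0)].

(* The ℝ-place associated with the ordering P: ζ x = a ∈ ℝ iff x is
   P-bounded and a = sup {q ∈ ℚ | q ≤_P x}, i.e. q ≤_P x ≤_P r for all
   rationals q < a < r; ζ x = ∞ iff x is P-unbounded. *)
Definition induces (F : fieldType) (P : F -> Prop) (z : F -> option RR) : Prop :=
  forall (x : F) (a : RR), z x = Some a <->
    (forall q r : rat, ratr q < a -> a < ratr r ->
        P (x - ratr q) /\ P (ratr r - x)).

Definition formally_real (F : fieldType) : Prop :=
  forall s : seq F, \sum_(x <- s) x ^+ 2 != -1.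

Definition is_real_closure (F : fieldType) (P : F -> Prop) (R' : rcfType)
  (s : {rmorphism F -> R'}) : Prop :=
  (forall x, P x <-> 0 <= s x) /\
  (forall z : R', exists p : {poly F}, p != 0 /\ root (map_poly s p) z).

(* Extension of a map on polynomial rings to the rational function fields
   (used with f = map_poly g for a field embedding g, so y ↦ y):
   n/d ↦ f(n)/f(d). *)
Definition frac_map (A B : idomainType) (f : A -> B) (x : {fraction A})
  : {fraction B} :=
  let r := repr x in (tofrac (f (frac r).1)) / (tofrac (f (frac r).2)).

(* Main.v *)
(* Only three properties of j_i = res_i o iota'_i : M(R(y)) -> M(F(y)) matter: it is
   continuous, it is compatible with restriction to R(y), and on F it gives the
   common place zeta of P_1 and P_2 (a real closed field has only one R-place).  Any
   two such lifts agree.  The places xi_a "y |-> a, followed by a place of R" are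
   dense, even with one point a removed, because a positive semidefinite polynomial
   over R is a sum of two squares; as M(F(y)) is Hausdorff, it suffices to compare
   j_1 and j_2 at each xi_a.  Put t = y - a.  If c in F is bounded by an element of R
   then j_i(xi_a) sends c t^n (n > 0) to 0, since xi_a sends t^n / r to 0 for all
   nonzero r in R.  Otherwise it sends c t^n to infinity: at xi_b with b != a this
   holds because t has the value of b - a there, and continuity carries it over to
   xi_a.  So every polynomial in t has a dominant monomial, the same for both places,
   and the places coincide. *)
Require Import Defs.
From HB Require Import structures.
From mathcomp Require Import all_boot all_order all_algebra.
From mathcomp Require Import complex polyrcf.
From mathcomp Require Import ring lra.
From mathcomp Require Import Rstruct.
From mathcomp Require Import boolp reals.
Set Implicit Arguments. Unset Strict Implicit. Unset Printing Implicit Defensive.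
Import Order.TTheory GRing.Theory Num.Theory.
Local Open Scope ring_scope.

(** * Positive semidefinite polynomials over a real closed field *)

Lemma poly_pos_near (R : rcfType) (p : {poly R}) (x : R) : 0 < p.[x] ->
  exists2 d, 0 < d & forall y, `|y - x| < d -> 0 < p.[y].
Proof.
move=> px; have [d d0 dP] := poly_cont x p px.
exists d => // y /dP; rewrite ltr_distl => /andP[+ _].
by rewrite subrr.
Qed.

(** Near [x] a cofactor nonzero at [x] keeps its sign while ['X - x%:P] changes sign, which would
    make [p] negative on one side; so the root has multiplicity at least two. *)
Lemma psd_root_double (R : rcfType) (p : {poly R}) (x : R) :
  (forall y, 0 <= p.[y]) -> root p x ->
  exists2 q, p = q * ('X - x%:P) ^+ 2 & forall y, 0 <= q.[y].
Proof.
move=> p0 /factor_theorem[q pE].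
have pqE y : p.[y] = q.[y] * (y - x) by rewrite pE !hornerE.
have qx : q.[x] = 0.
  case: (ltgtP q.[x] 0) => // qx.
    have : 0 < (- q).[x] by rewrite hornerN oppr_gt0.
    case/poly_pos_near=> d d0 /(_ (x + d / 2)).
    rewrite addrAC subrr add0r gtr0_norm ?divr_gt0// ltr_pdivrMr// => /(_ ltac:(lra)).
    rewrite hornerN => h; have := p0 (x + d / 2); rewrite pqE; nra.
  case/poly_pos_near: qx => d d0 /(_ (x - d / 2)).
  rewrite addrAC subrr add0r normrN gtr0_norm ?divr_gt0// ltr_pdivrMr// => /(_ ltac:(lra)).
  move=> h; have := p0 (x - d / 2); rewrite pqE; nra.
have /factor_theorem[r qE] : root q x by apply/eqP.
exists r => [|y]; first by rewrite pE qE expr2 mulrA.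
have r0 y' : y' != x -> 0 <= r.[y'].
  move=> yx; have := p0 y'; rewrite pqE qE !hornerE -mulrA -expr2.
  by rewrite pmulr_lge0 // exprn_even_gt0//= subr_eq0.
have [->|/r0//] := eqVneq y x.
(* Away from [x] the sign of [r] is that of [p]; a negative value at [x] would spread to [x + d / 2]
   by continuity. *)
rewrite leNgt; apply/negP => rx.
have : 0 < (- r).[x] by rewrite hornerN oppr_gt0.
case/poly_pos_near=> d d0 /(_ (x + d / 2)).
rewrite addrAC subrr add0r gtr0_norm ?divr_gt0// ltr_pdivrMr// => /(_ ltac:(lra)).
rewrite hornerN => h; have := r0 (x + d / 2).
rewrite -subr_eq0 addrAC subrr add0r => /(_ ltac:(by rewrite gt_eqF// divr_gt0)).
lra.
Qed.

(** The remainder of [p] modulo the quadratic is linear and vanishes at x + iy. Its imaginary part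
    there is y times its slope, so the slope is zero, and then so is the constant term. *)
Lemma nonreal_root_factor (R : rcfType) (p : {poly R}) (x y : R) :
  y != 0 -> root (map_poly (real_complex R) p) (Complex x y) ->
  exists q, p = q * (('X - x%:P) ^+ 2 + y%:P ^+ 2).
Proof.
move=> y0; set Q := _ + _ => pz.
have sQ : size Q = 3%N.
  rewrite /Q size_polyDl size_exp_XsubC// -rmorphXn/= (leq_ltn_trans (size_polyC_leq1 _))//.
have Q0 : Q != 0 by rewrite -size_poly_eq0 sQ.
exists (p %/ Q); rewrite {1}(divp_eq p Q).
suff -> : p %% Q = 0 by rewrite addr0.
have := ltn_modp p Q; rewrite Q0 sQ; set r := _ %% _ => sr.
have rz : root (map_poly (real_complex R) r) (Complex x y).
  move: pz; rewrite {1}(divp_eq p Q) -/r rmorphD rmorphM /root !hornerE.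
  suff -> : (map_poly (real_complex R) Q).[Complex x y] = 0 by rewrite mulr0 add0r.
  rewrite /Q rmorphD !rmorphXn/= rmorphB/= map_polyX !map_polyC/= !hornerE.
  rewrite !expr2; apply/eqP; rewrite eq_complex/=; apply/andP; split; apply/eqP; ring.
have rE : r = r`_1 *: 'X + (r`_0)%:P.
  apply/polyP => i; rewrite !coefE.
  case: i => [|[|i]] /=; rewrite ?mulr0 ?mulr1 ?add0r ?addr0 //.
  by rewrite nth_default //; apply: leq_trans (_ : 2 <= _)%N.

move: rz; rewrite rE rmorphD/= map_polyZ/= map_polyX map_polyC /root !hornerE.
rewrite eq_complex/= => /andP[/eqP h1 /eqP h2].
have r1 : r`_1 = 0.
  apply: (mulIf y0); move: h2; rewrite /=; lra.
have r0 : r`_0 = 0 by move: h1; rewrite r1 /=; lra.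
by rewrite r1 r0 scale0r add0r.
Qed.

(** Induction on the size. Since R[i] is algebraically closed, a nonconstant [p] has a root there; a
    real root splits off a square, a nonreal one a positive quadratic that is itself a sum of two
    squares. The cofactor stays positive semidefinite. *)
Lemma psd_sum2sq (R : rcfType) (p : {poly R}) : (forall x, 0 <= p.[x]) ->
  exists A B : {poly R}, p = A ^+ 2 + B ^+ 2.
Proof.
have [n] := ubnP (size p); elim: n p => // n IH p; rewrite ltnS => sp p0.
have [p1|p1] := leqP (size p) 1.
  exists (Num.sqrt p.[0])%:P, 0; rewrite expr0n addr0 -rmorphXn/= sqr_sqrtr//.
  by rewrite horner_coef0 -size1_polyC.
have pn0 : p != 0 by rewrite -size_poly_gt0; apply: ltn_trans p1.
have /closed_rootP[[x y] pz] : size (map_poly (real_complex R) p) != 1%N.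
  by rewrite size_map_poly gtn_eqF.
have size_quot (q D : {poly R}) : p = q * D -> (1 < size D)%N -> (size q < n)%N.
  move=> pE sD; apply: leq_trans sp.
  have D0 : D != 0 by rewrite -size_poly_gt0; apply: ltn_trans sD.
  have q0 : q != 0 by apply: contraNneq pn0 => q0; rewrite pE q0 mul0r.
  rewrite pE size_mul//; move: sD; case: (size D) => [|[|k]]//= _.
  by rewrite addnS/= addnS ltnS leq_addr.
have [y0|y0] := eqVneq y 0.
  have px : root p x.
    by move: pz; rewrite y0 -[Complex x 0]/(real_complex R x) fmorph_root.
  have [q pE q0] := psd_root_double p0 px.
  have [|A [B qE]] := IH q _ q0.
    by apply: size_quot pE _; rewrite size_exp_XsubC.
  by exists (A * ('X - x%:P)), (B * ('X - x%:P)); rewrite pE qE; ring.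
have [q pE] := nonreal_root_factor y0 pz.
set D := _ + _ in pE.
have D_gt0 z : 0 < D.[z].
  by rewrite !hornerE ltr_wpDl ?sqr_ge0// exprn_even_gt0.
have q0 z : 0 <= q.[z] by have := p0 z; rewrite pE hornerM pmulr_lge0.
have [|A [B qE]] := IH q _ q0.
  apply: size_quot pE _.
  by rewrite /D size_polyDl size_exp_XsubC// -rmorphXn/= (leq_ltn_trans (size_polyC_leq1 _)).
(* Brahmagupta's identity *)
exists (A * ('X - x%:P) - B * y%:P), (A * y%:P + B * ('X - x%:P)).
by rewrite pE qE /D; ring.
Qed.

(** * Real places *)

Section Place.
Variables (K : fieldType) (z : K -> option RR).
Hypothesis z_place : is_Rplace z.

Lemma place1 : z 1 = Some 1. Proof. by case: z_place. Qed.

Lemma placeN x a : z x = Some a -> z (- x) = Some (- a).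
Proof. by case: z_place => _ + _ _; apply. Qed.

Lemma placeD x y a b : z x = Some a -> z y = Some b -> z (x + y) = Some (a + b).
Proof. by case: z_place => _ _ zDM _ zx zy; have [] := zDM _ _ _ _ zx zy. Qed.

Lemma placeM x y a b : z x = Some a -> z y = Some b -> z (x * y) = Some (a * b).
Proof. by case: z_place => _ _ zDM _ zx zy; have [] := zDM _ _ _ _ zx zy. Qed.

Lemma placeB x y a b : z x = Some a -> z y = Some b -> z (x - y) = Some (a - b).
Proof. by move=> zx /placeN; apply: placeD. Qed.

Lemma place0 : z 0 = Some 0.
Proof. by rewrite -(subrr 1) (placeB place1 place1) subrr. Qed.

Lemma placeX x a n : z x = Some a -> z (x ^+ n) = Some (a ^+ n).
Proof.
move=> zx; elim: n => [|n IH]; first by rewrite !expr0 place1.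
by rewrite !exprS; apply: placeM.
Qed.

Lemma place_neq0 x a : z x = Some a -> a != 0 -> x != 0.
Proof. by move=> zx; apply: contra_neq => x0; move: zx; rewrite x0 place0 => -[]. Qed.

Lemma place_inf_neq0 x : z x = None -> x != 0.
Proof. by move=> zx; apply/eqP => x0; move: zx; rewrite x0 place0. Qed.

Lemma place_infV x : z x = None -> z x^-1 = Some 0.
Proof. by move=> zx; case: z_place => _ _ _ /(_ x (place_inf_neq0 zx))[+ _]; apply. Qed.

Lemma place_V0 x : x != 0 -> z x = Some 0 -> z x^-1 = None.
Proof.
move=> x0 zx; case: z_place => _ _ _ /(_ x^-1); rewrite invr_eq0 invrK => /(_ x0)[_].
exact.
Qed.

Lemma placeV x a : z x = Some a -> a != 0 -> z x^-1 = Some a^-1.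
Proof.
move=> zx a0; have x0 := place_neq0 zx a0.
case zV: (z x^-1) => [b|].
  have := placeM zx zV; rewrite divff// place1 => -[ab].
  by rewrite -[b]mul1r -(mulVf a0) -mulrA -ab mulr1.
by move: (place_infV zV); rewrite invrK zx => -[a00]; rewrite a00 eqxx in a0.
Qed.

Lemma place_div x y a b : z x = Some a -> z y = Some b -> b != 0 -> z (x / y) = Some (a / b).
Proof. by move=> zx zy b0; apply: placeM => //; apply: placeV. Qed.

Lemma place_infM x y b : z x = None -> z y = Some b -> b != 0 -> z (x * y) = None.
Proof.
move=> zx zy b0; case zxy: (z (x * y)) => [c|//].
have := place_div zxy zy b0; rewrite mulfK ?zx//; exact: place_neq0 zy b0.
Qed.

Lemma place_mul_unit x y : z y = Some 1 -> z (x * y) = z x.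
Proof.
move=> zy; case zx: (z x) => [a|].
  by rewrite (placeM zx zy) mulr1.
by rewrite (place_infM zx zy) ?oner_eq0.
Qed.

Lemma place_nat n : z n%:R = Some n%:R.
Proof.
elim: n => [|n IH]; first exact: place0.
by rewrite -!natr1; apply: placeD => //; apply: place1.
Qed.

Lemma place_int (n : int) : z n%:~R = Some n%:~R.
Proof.
case: n => n; first exact: place_nat.
by rewrite NegzE !mulrNz; apply: placeN; apply: place_nat.
Qed.

Lemma place_rat (q : rat) : z (ratr q) = Some (ratr q).
Proof. by apply: place_div; rewrite ?place_int // intr_eq0. Qed.

(** For finite [x] the value is at least 1; for infinite [x] the same argument applies to 1 + x^-2,
    which has value 1. *)
Lemma place_1Dsqr (x : K) : 1 + x ^+ 2 != 0.
Proof.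
apply/eqP => x1; case zx: (z x) => [a|].
  have := placeD place1 (placeX 2 zx); rewrite x1 place0 => -[].
  have := sqr_ge0 a; lra.
have x0 := place_inf_neq0 zx.
have := placeD place1 (placeX 2 (place_infV zx)); rewrite expr0n addr0.
have -> : 1 + x^-1 ^+ 2 = 0 by rewrite -[RHS](mul0r (x ^- 2)) -x1; field.
by rewrite place0 => -[] /esym/eqP; rewrite oner_eq0.
Qed.

(** Squares cannot cancel: after factoring out the dominant square, the other factor 1 + (x / y)^2
    has a finite nonzero value. *)
Lemma place_sum2sq x y c : z (x ^+ 2 + y ^+ 2) = Some c ->
  exists a b, [/\ z x = Some a, z y = Some b & c = a ^+ 2 + b ^+ 2].
Proof.
(* Unless [y] is zero, one of x / y and y / x is finite; the roles of [x] and [y] are exchanged if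
   necessary. *)
wlog [a zxy] : x y / exists a, z (x / y) = Some a /\ y != 0.
  move=> wl; have [->|y0] := eqVneq y 0.
    rewrite expr0n addr0 => zx; case zx1 : (z x) => [a|].
      exists a, 0; rewrite expr0n addr0; split => //; first exact: place0.
      by have := placeX 2 zx1; rewrite zx => -[].
    have x0 := place_inf_neq0 zx1.
    have := placeM zx (placeX 2 (place_infV zx1)).
    by rewrite exprVn divff ?expf_eq0// place1 expr0n mulr0 => -[] /eqP; rewrite oner_eq0.
  case zxy: (z (x / y)) => [a|]; first by apply: wl; exists a.
  have xy0 := place_inf_neq0 zxy.
  rewrite addrC => /(wl y x)[].
    exists 0; rewrite -[y / x]invrK invf_div place_infV//; split => //.
    by apply: contraNneq xy0 => ->; rewrite mul0r.
  by move=> a [b [? ? ->]]; exists b, a; rewrite addrC.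
case: zxy => zxy y0.
have a1 : 1 + a ^+ 2 != 0 by rewrite gt_eqF // ltr_pwDl ?sqr_ge0.
have zs := placeD place1 (placeX 2 zxy).
have -> : x ^+ 2 + y ^+ 2 = y ^+ 2 * (1 + (x / y) ^+ 2) by field.
move=> zc; have := place_div zc zs a1; rewrite mulfK ?(place_neq0 zs)// => zy2.
case zy: (z y) => [b|].
  have zx := placeM zxy zy; rewrite divfK// in zx.
  exists (a * b), b; split => //; have := placeM (placeX 2 zy) zs; rewrite zc => -[->]; ring.
have := placeM zy2 (placeX 2 (place_infV zy)).
by rewrite exprVn divff ?expf_eq0 ?(negPf y0)// place1 expr0n mulr0 => -[] /eqP; rewrite oner_eq0.
Qed.

Lemma place_sum2sq_ge0 x y c : z (x ^+ 2 + y ^+ 2) = Some c -> 0 <= c.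
Proof. by move=> /place_sum2sq[a [b [_ _ ->]]]; rewrite addr_ge0 ?sqr_ge0. Qed.

End Place.

Lemma place_comp (K L : fieldType) (j : {rmorphism K -> L}) (z : L -> option RR) :
  is_Rplace z -> is_Rplace (z \o j).
Proof.
move=> [z1 zN zDM zV]; split => /= [|x a|x y a b|x].
- by rewrite rmorph1.
- by rewrite rmorphN; apply: zN.
- by rewrite rmorphD rmorphM; apply: zDM.
- by rewrite -(fmorph_eq0 j) fmorphV; apply: zV.
Qed.

Lemma rat_between (a b : RR) : a < b -> exists2 q : rat, a < ratr q & ratr q < b.
Proof. by move=> /rat_in_itvoo[q]; rewrite in_itv/= => /andP[]; exists q. Qed.

(** * Places of a real closed field *)

Section PlaceRcf.
Variables (R : rcfType) (z : R -> option RR).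
Hypothesis z_place : is_Rplace z.

Lemma place_ge0 x a : 0 <= x -> z x = Some a -> 0 <= a.
Proof.
move=> x0 zx; apply: (place_sum2sq_ge0 z_place (x := Num.sqrt x) (y := 0)).
by rewrite expr0n addr0 sqr_sqrtr// zx.
Qed.

Lemma place_le x y a b : x <= y -> z x = Some a -> z y = Some b -> a <= b.
Proof.
move=> xy zx zy; rewrite -subr_ge0; apply: place_ge0 (placeB z_place zy zx).
by rewrite subr_ge0.
Qed.

Lemma place_bounded (q r : rat) x : ratr q <= x -> x <= ratr r ->
  exists2 a, z x = Some a & ratr q <= a <= ratr r.
Proof.
move=> qx xr; case zx: (z x) => [a|].
  exists a => //; apply/andP; split.
    exact: place_le qx (place_rat z_place q) zx.
  exact: place_le xr zx (place_rat z_place r).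
have x0 := place_inf_neq0 z_place zx.
have zV := place_infV z_place zx.
(* [z x^-1 = Some 0] contradicts [x ^+ 2 <= q ^+ 2 + r ^+ 2] *)
pose s : rat := q ^+ 2 + r ^+ 2.
have xs : x ^+ 2 <= ratr s.
  rewrite rmorphD !rmorphXn/=; have [x1|x1] := leP 0 x; nra.
have : 1 <= ratr s * x^-1 ^+ 2.
  by rewrite exprVn ler_pdivlMr ?mul1r// exprn_even_gt0.
move=> /place_le/(_ (place1 z_place) (placeM z_place (place_rat z_place s) (placeX z_place 2 zV))).
by rewrite expr0n mulr0 ler10.
Qed.

(** A value other than [a] would be separated from [a] by a rational that bounds [x] on the wrong
    side. Hence the order alone determines the place. *)
Lemma place_order_eq x a :
  (forall q r : rat, ratr q < a -> a < ratr r -> ratr q <= x <= ratr r) -> z x = Some a.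
Proof.
move=> xa.
have [q0 _ q0a] : exists2 q : rat, a - 1 < ratr q & ratr q < a by apply: rat_between; lra.
have [r0 ar0 _] : exists2 q : rat, a < ratr q & ratr q < a + 1 by apply: rat_between; lra.
have /andP[qx xr] := xa _ _ q0a ar0.
have [b zx _] := place_bounded qx xr; rewrite zx; congr Some.
apply/eqP; rewrite eq_le; apply/andP; split; rewrite leNgt; apply/negP => /rat_between[p p1 p2].
  have /andP[_] := xa _ _ q0a p1.
  by move=> /place_le/(_ zx (place_rat z_place p)); rewrite leNgt p2.
have /andP[+ _] := xa _ _ p2 ar0.
by move=> /place_le/(_ (place_rat z_place p) zx); rewrite leNgt p1.
Qed.

End PlaceRcf.

(** * Rational function fields and their places at a point *)

Notation "x %:F" := (tofrac x) (format "x %:F").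

(** Links the representative used in [frac_map] to division in the fraction field. *)
Lemma frac_repr (A : idomainType) (x : {fraction A}) :
  x = (frac (repr x)).1%:F / (frac (repr x)).2%:F.
Proof.
have d0 : (frac (repr x)).2%:F != 0 by rewrite tofrac_eq0 denom_ratioP.
apply: (mulIf d0); rewrite divfK//.
rewrite -{1}[x]reprK; move: (repr x) => {d0}x.
unlock tofrac; rewrite -[LHS]FracField.pi_mul.
apply/eqmodP; rewrite /= FracField.equivfE /FracField.mulf.
by rewrite !numden_Ratio ?mulf_neq0 ?denom_ratioP ?oner_eq0//= !mulr1 mulrC.
Qed.

Lemma fracP (A : idomainType) (x : {fraction A}) :
  exists n d, d != 0 /\ x = n%:F / d%:F.
Proof. by exists (frac (repr x)).1, (frac (repr x)).2; rewrite denom_ratioP -frac_repr. Qed.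

Lemma frac_eq (A : idomainType) (n d n' d' : A) : d != 0 -> d' != 0 ->
  (n%:F / d%:F == n'%:F / d'%:F) = (n * d' == n' * d).
Proof. by move=> d0 d0'; rewrite eqr_div ?tofrac_eq0// -!tofracM tofrac_eq. Qed.

Section FracMap.
Variables (A B : idomainType) (f : {rmorphism A -> B}).
Hypothesis f_inj : injective f.

(** [frac_map] does not depend on the chosen representative; injectivity of [f] keeps the
    denominators nonzero. *)
Lemma frac_mapE (n d : A) : d != 0 ->
  frac_map f (n%:F / d%:F) = (f n)%:F / (f d)%:F.
Proof.
move=> d0; rewrite /frac_map /=; set r := repr _.
have fd0 c : c != 0 -> f c != 0 by rewrite (raddf_eq0 _ f_inj).
apply/eqP; rewrite frac_eq ?fd0 ?denom_ratioP// -!rmorphM (inj_eq f_inj).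
by rewrite -frac_eq ?denom_ratioP// -frac_repr.
Qed.

Lemma frac_map_zmod_morphism : zmod_morphism (frac_map f).
Proof.
move=> x y; have [n [d [d0 ->]]] := fracP x; have [n' [d' [d0' ->]]] := fracP y.
have fd0 c : c != 0 -> f c != 0 by rewrite (raddf_eq0 _ f_inj).
rewrite !frac_mapE// -!mulNr -!tofracN !addf_div ?tofrac_eq0 ?fd0//.
rewrite -!tofracM -!tofracD frac_mapE ?mulf_neq0//.
by rewrite !(rmorphD, rmorphM, rmorphN).
Qed.

Lemma frac_map_monoid_morphism : monoid_morphism (frac_map f).
Proof.
split=> [|x y].
  have -> : 1 = 1%:F / 1%:F :> {fraction A} by rewrite tofrac1 divr1.
  by rewrite frac_mapE ?oner_eq0// rmorph1 tofrac1 divr1.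
have [n [d [d0 ->]]] := fracP x; have [n' [d' [d0' ->]]] := fracP y.
rewrite !frac_mapE// !mulf_div -!tofracM frac_mapE ?mulf_neq0//.
by rewrite !rmorphM.
Qed.

End FracMap.

(** A named form of the map, to which the ring morphism structure is attached. *)
Definition ratfun_map (K L : fieldType) (s : {rmorphism K -> L}) :=
  frac_map (map_poly s).

HB.instance Definition _ (K L : fieldType) (s : {rmorphism K -> L}) :=
  GRing.isZmodMorphism.Build _ _ (ratfun_map s)
    (frac_map_zmod_morphism (map_poly_inj s)).
HB.instance Definition _ (K L : fieldType) (s : {rmorphism K -> L}) :=
  GRing.isMonoidMorphism.Build _ _ (ratfun_map s)
    (frac_map_monoid_morphism (map_poly_inj s)).

Lemma ratfun_map_tofrac (K L : fieldType) (s : {rmorphism K -> L}) p :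
  ratfun_map s p%:F = (map_poly s p)%:F.
Proof.
have -> : p%:F = p%:F / 1%:F by rewrite tofrac1 divr1.
by rewrite /ratfun_map frac_mapE ?oner_eq0 ?rmorph1 ?tofrac1 ?divr1//; apply: map_poly_inj.
Qed.

Lemma ratfun_map_frac (K L : fieldType) (s : {rmorphism K -> L}) n d : d != 0 ->
  ratfun_map s (n%:F / d%:F) = (map_poly s n)%:F / (map_poly s d)%:F.
Proof. by apply: frac_mapE; apply: map_poly_inj. Qed.

Lemma ratfun_map_comp (K L L' : fieldType) (s : {rmorphism K -> L})
    (s' : {rmorphism L -> L'}) x :
  ratfun_map (s' \o s) x = ratfun_map s' (ratfun_map s x).
Proof.
have [n [d [d0 ->]]] := fracP x.
rewrite (ratfun_map_frac s) // (ratfun_map_frac s') ?map_poly_eq0//.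
by rewrite ratfun_map_frac// -!map_poly_comp.
Qed.

Section ValueAt.
Variables (K : fieldType) (a : K).
Implicit Types x y : {fraction {poly K}}.

(** The graph of evaluation on the local ring at [a]. It is a relation because a fraction may have a
    pole at [a], and because some but not all of its denominators may vanish there. *)
Definition value_at x c :=
  exists n d : {poly K}, [/\ x = n%:F / d%:F, d.[a] != 0 & c = n.[a] / d.[a]].

Let denom_neq0 (d : {poly K}) : d.[a] != 0 -> d != 0.
Proof. by apply: contraNneq => ->; rewrite horner0. Qed.

Lemma value_at_uniq x c c' : value_at x c -> value_at x c' -> c = c'.
Proof.
move=> [n [d [-> d0 ->]]] [n' [d' [+ d0' ->]]] => /eqP.
rewrite frac_eq ?denom_neq0// => /eqP/(congr1 (horner^~ a)).
by rewrite !hornerM => e; apply/eqP; rewrite eqr_div// e.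
Qed.

Lemma value_at_tofrac p : value_at p%:F p.[a].
Proof. by exists p, 1; rewrite tofrac1 divr1 hornerC oner_eq0 divr1. Qed.

Lemma value_atN x c : value_at x c -> value_at (- x) (- c).
Proof.
move=> [n [d [-> d0 ->]]]; exists (- n), d.
by rewrite tofracN hornerN !mulNr.
Qed.

Lemma value_atD x y c c' : value_at x c -> value_at y c' -> value_at (x + y) (c + c').
Proof.
move=> [n [d [-> d0 ->]]] [n' [d' [-> d0' ->]]].
exists (n * d' + n' * d), (d * d'); rewrite hornerM mulf_neq0//.
rewrite hornerD !hornerM !addf_div// ?tofrac_eq0 ?denom_neq0//.
by rewrite tofracD !tofracM.
Qed.

Lemma value_atM x y c c' : value_at x c -> value_at y c' -> value_at (x * y) (c * c').
Proof.
move=> [n [d [-> d0 ->]]] [n' [d' [-> d0' ->]]].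
exists (n * n'), (d * d'); rewrite hornerM mulf_neq0//.
by rewrite hornerM !mulf_div !tofracM.
Qed.

Lemma value_atV x c : c != 0 -> value_at x c -> value_at x^-1 c^-1.
Proof.
move=> c0 [n [d [-> d0 cE]]]; exists d, n; rewrite cE !invf_div; split => //.
by apply: contraNneq c0 => n0; rewrite cE n0 mul0r.
Qed.

(** The local ring at [a] is a valuation ring: the multiplicities of [a] in numerator and
    denominator are compared and the common power is cancelled. *)
Lemma value_at_or_inv x : (exists c, value_at x c) \/ value_at x^-1 0.
Proof.
have [n [d [d0 ->]]] := fracP x.
have [->|n0] := eqVneq n 0.
  left; exists 0; rewrite tofrac0 mul0r -tofrac0 -[X in value_at _ X](horner0 a).
  exact: value_at_tofrac.
have [i [q + nE]] := multiplicity_XsubC n a; rewrite n0 /= => qa.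
have [j [r + dE]] := multiplicity_XsubC d a; rewrite d0 /= => ra.
rewrite !rootE in qa ra.
have X0 k : (('X - a%:P) ^+ k)%:F != 0 :> {fraction {poly K}}.
  by rewrite tofrac_eq0 expf_neq0// polyXsubC_eq0.
have [ij|ij] := leqP j i.
  left; exists ((q * ('X - a%:P) ^+ (i - j)).[a] / r.[a]).
  exists (q * ('X - a%:P) ^+ (i - j)), r; split => //.
  rewrite nE dE -{1}(subnK ij) exprD mulrA (tofracM _ (_ ^+ j)) (tofracM r).
  by rewrite -mulf_div divff ?mulr1.
right; exists (r * ('X - a%:P) ^+ (j - i)), q; split => //.
  rewrite invf_div nE dE -{1}(subnK (ltnW ij)) exprD mulrA (tofracM _ (_ ^+ i)) (tofracM q).
  by rewrite -mulf_div divff ?mulr1.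
by rewrite !hornerE subrr expr0n subn_eq0 leqNgt ij mulr0 mul0r.
Qed.

(* The composite of the specialisation [y |-> a] with the place [lam]. *)
Definition place_at (lam : K -> option RR) x : option RR :=
  if pselect (exists c, value_at x c) is left h then lam (projT1 (cid h)) else None.

Lemma place_atE lam x c : value_at x c -> place_at lam x = lam c.
Proof.
move=> xc; rewrite /place_at; case: pselect => [h|[]]; last by exists c.
by case: (cid h) => c' /= /value_at_uniq/(_ xc) ->.
Qed.

Lemma place_at_Some lam x b : place_at lam x = Some b ->
  exists2 c, value_at x c & lam c = Some b.
Proof.
rewrite /place_at; case: pselect => // h.
by case: (cid h) => c /= xc; exists c.
Qed.

Lemma place_atP lam : is_Rplace lam -> is_Rplace (place_at lam).
Proof.
move=> lamP; split=> [|x b|x y b b'|x x0].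
- by rewrite -tofrac1 (place_atE _ (value_at_tofrac 1)) hornerC; apply: place1.
- move=> /place_at_Some[c xc lc].
  by rewrite (place_atE _ (value_atN xc)) (placeN lamP lc).
- move=> /place_at_Some[c xc lc] /place_at_Some[c' yc' lc'].
  rewrite (place_atE _ (value_atD xc yc')) (place_atE _ (value_atM xc yc')).
  by split; [apply: placeD|apply: placeM].
- split=> [xN|/place_at_Some[c xc lc]].
    have [[c xc]|xV] := value_at_or_inv x; last by rewrite (place_atE _ xV) place0.
    move: xN; rewrite (place_atE _ xc) => lc.
    rewrite (place_atE _ (value_atV _ xc)) ?(place_infV lamP)//.
    exact: (place_inf_neq0 lamP lc).
  have [c0|c0] := eqVneq c 0; last first.
    rewrite -[x]invrK (place_atE _ (value_atV c0 xc)); exact: place_V0.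
  (* If [x] specialises to 0, its inverse has no value, since otherwise 1 would specialise to 0. *)
  rewrite /place_at; case: pselect => // -[d xd]; exfalso.
  move: (value_atM xc xd); rewrite mulVf// c0 mul0r => h.
  have := value_at_uniq h (value_at_tofrac 1).
  by rewrite hornerC => /esym/eqP; rewrite oner_eq0.
Qed.

End ValueAt.

(** * The topology of the space of real places *)

Section Topology.
Variable K : fieldType.
Implicit Types (zeta xi : M K) (b c h : K).

(** After rational rescaling, [h] is positive exactly when the pair of rescaled functions lies in
    the open unit disc around (2, 2), and this disc lies in the open positive quadrant. *)
Lemma HpI zeta b c : Hp b zeta -> Hp c zeta ->
  exists2 h, Hp h zeta & forall xi, Hp h xi -> Hp b xi /\ Hp c xi.
Proof.
move=> [vb [zb b0]] [vc [zc c0]].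
have zP := svalP zeta.
(* These bounds put both rescaled values at [zeta] between 3/2 and 2, hence inside the disc. *)
have [p p1 p2] : exists2 p : rat, vb / 2 < ratr p & ratr p < 2 / 3 * vb by apply: rat_between; lra.
have [q q1 q2] : exists2 p : rat, vc / 2 < ratr p & ratr p < 2 / 3 * vc by apply: rat_between; lra.
have p0 : 0 < ratr p :> RR by lra.
have q0 : 0 < ratr q :> RR by lra.
exists (1 - ((b / ratr p - 2%:R) ^+ 2 + (c / ratr q - 2%:R) ^+ 2)).
  exists (1 - ((vb / ratr p - 2) ^+ 2 + (vc / ratr q - 2) ^+ 2)); split.
    have near (x : K) vx (s : rat) : sval zeta x = Some vx -> 0 < ratr s :> RR ->
        sval zeta ((x / ratr s - 2%:R) ^+ 2) = Some ((vx / ratr s - 2) ^+ 2).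
      move=> zx s0; apply: placeX => //; apply: placeB (place_nat _ _) => //.
      by apply: place_div; rewrite ?gt_eqF//; apply: place_rat.
    by apply: placeB (place1 zP) _ => //; apply: placeD => //; apply: near.
  have b1 : vb / ratr p < 2 by rewrite ltr_pdivrMr//; lra.
  have b2 : 3 / 2 < vb / ratr p by rewrite ltr_pdivlMr//; lra.
  have c1 : vc / ratr q < 2 by rewrite ltr_pdivrMr//; lra.
  have c2 : 3 / 2 < vc / ratr q by rewrite ltr_pdivlMr//; lra.
  nra.
move=> xi [e [xh e0]]; have xP := svalP xi.
have := placeB xP (place1 xP) xh; rewrite opprB addrC subrK.
move=> /(place_sum2sq xP)[u [v [xu xv euv]]].
have pos (x : K) w (s : rat) : 0 < ratr s :> RR ->
    sval xi (x / ratr s - 2%:R) = Some w -> -1 < w -> Hp x xi.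
  move=> s0 xw w1; exists ((w + 2) * ratr s); split; last first.
    by rewrite mulr_gt0//; lra.
  have s0' : ratr s != 0 :> K by apply: (place_neq0 xP (place_rat xP s)); rewrite gt_eqF.
  rewrite -[x](divfK s0'); apply: placeM (place_rat xP s) => //.
  by rewrite -[x / _](subrK 2%:R); apply: placeD (place_nat xP 2).
by split; [apply: pos p0 xu _|apply: pos q0 xv _]; nra.
Qed.

(** The subbasis is thus a basis, so that a neighbourhood can be tested with a single function. *)
Lemma Hp_basis zeta (s : seq K) : (forall b, b \in s -> Hp b zeta) ->
  exists2 h, Hp h zeta & forall xi, Hp h xi -> forall b, b \in s -> Hp b xi.
Proof.
elim: s => [|b s IH] zs.
  by exists 1 => //; exists 1; split; [apply: place1 (svalP zeta)|apply: ltr01].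
have [|h zh hs] := IH; first by move=> c cs; apply: zs; rewrite inE cs orbT.
have [|h' zh' hh'] := @HpI zeta b h _ zh; first by apply: zs; rewrite inE eqxx.
exists h' => // xi /hh'[xb xh] c; rewrite inE => /predU1P[->//|]; exact: hs.
Qed.

Lemma Mcontinuous_Hp (L : fieldType) (f : M K -> M L) zeta (u : L) :
  Mcontinuous f -> Hp u (f zeta) ->
  exists2 h, Hp h zeta & forall xi, Hp h xi -> Hp u (f xi).
Proof.
move=> fc fu; have uopen : Mopen (Hp u : M L -> Prop).
  move=> th thu; exists [:: u]; split => [b|xi]; first by rewrite inE => /eqP ->.
  by apply; rewrite inE.
have [s [zs sU]] := fc _ uopen zeta fu.
have [h zh hs] := Hp_basis zs.
by exists h => // xi /hs/sU.
Qed.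

End Topology.

Definition Mplace_at (K : fieldType) (lam : K -> option RR) (lamP : is_Rplace lam)
  (b : K) : M {fraction {poly K}} := exist _ (place_at b lam) (place_atP b lamP).

(* Were [(h - q) (r - h) <= 0] wherever defined on the line, it would be minus a sum
   of two squares, and so could not have positive value at [xi]. *)
Lemma place_at_dense (R : rcfType) (lam : R -> option RR) (lamP : is_Rplace lam)
    (a : R) (xi : M {fraction {poly R}}) h :
  Hp h xi -> exists2 b, b != a & Hp h (Mplace_at lamP b).
Proof.
move=> [v [xh v0]]; have xP := svalP xi.
have [q q0 qv] := rat_between v0.
have [r vr _] : exists2 r : rat, v < ratr r & ratr r < v + 1 by apply: rat_between; lra.
have [n [d [d0 hE]]] := fracP h.
(* [N] is (h - q)(r - h) cleared of the denominator d^2; where it is positive, [h] lies between [q]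
   and [r]. *)
pose N := (n - (ratr q) *: d) * ((ratr r) *: d - n).
have [[b [ba db Nb]]|noN] :=
  pselect (exists b, [/\ b != a, d.[b] != 0 & 0 < N.[b]]).
  exists b => //; rewrite /Hp /=.
  have hb : value_at b h (n.[b] / d.[b]) by exists n, d.
  rewrite (place_atE _ hb).
  have qr : ratr q < ratr r :> R by move: (lt_trans qv vr); rewrite !ltr_rat.
  have : 0 < (n.[b] / d.[b] - ratr q) * (ratr r - n.[b] / d.[b]).
    have -> : (n.[b] / d.[b] - ratr q) * (ratr r - n.[b] / d.[b]) = N.[b] / d.[b] ^+ 2.
      by rewrite /N !hornerE; field.
    by rewrite divr_gt0// exprn_even_gt0.
  move=> c0; have [||e lc /andP[qe _]] := @place_bounded _ _ lamP q r (n.[b] / d.[b]).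
  - nra.
  - nra.
  by exists e; split=> //; apply: lt_le_trans qe.
(* The factor (y - a)^2 makes the polynomial vanish at the excluded point [a], where nothing is
   known about the sign of [N]. *)
exfalso; pose X := 'X - a%:P.
have X0 : X != 0 by rewrite polyXsubC_eq0.
have [b|A [B AB]] := @psd_sum2sq _ (- N * X ^+ 2).
  have [->|ba] := eqVneq b a; first by rewrite hornerM horner_exp hornerXsubC subrr expr0n mulr0.
  rewrite hornerM horner_exp hornerN mulr_ge0 ?sqr_ge0// oppr_ge0.
  (* At a zero of [d], the value of - N is the square of that of [n]. *)
  have [db|db] := eqVneq d.[b] 0.
    by rewrite /N !hornerE db; nra.
  by rewrite leNgt; apply/negP => Nb; apply: noN; exists b.
have qE : (ratr q : {fraction {poly R}}) = (ratr q)%:P%:F.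
  by rewrite -(fmorph_rat (@tofrac _ \o @polyC R)).
have rE : (ratr r : {fraction {poly R}}) = (ratr r)%:P%:F.
  by rewrite -(fmorph_rat (@tofrac _ \o @polyC R)).
have hAB : - ((h - ratr q) * (ratr r - h)) =
    (A%:F / (d%:F * X%:F)) ^+ 2 + (B%:F / (d%:F * X%:F)) ^+ 2.
  have alg (K : fieldType) (n' d' x' q' r' : K) : d' != 0 -> x' != 0 ->
      - ((n' / d' - q') * (r' - n' / d')) =
      - ((n' - q' * d') * (r' * d' - n')) * x' ^+ 2 / (d' * x') ^+ 2.
    by move=> d0' x0'; field; apply/andP.
  rewrite hE (alg _ _ _ X%:F) ?tofrac_eq0// !expr_div_n -mulrDl -!tofracXn -tofracD -AB /N qE rE.
  by rewrite -!mul_polyC -!(tofracM, tofracXn, tofracN, tofracB).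
have := placeN xP (placeM xP (placeB xP xh (place_rat xP q)) (placeB xP (place_rat xP r) xh)).
rewrite hAB => /(place_sum2sq_ge0 xP); nra.
Qed.

(** * Continuous lifts of places *)

Lemma const_neq0 (K : fieldType) (c : K) : c != 0 -> c%:P%:F != 0.
Proof. by rewrite tofrac_eq0 polyC_eq0. Qed.

Lemma constM (K : fieldType) (c d : K) : (c * d)%:P%:F = c%:P%:F * d%:P%:F.
Proof. by rewrite polyCM tofracM. Qed.

Lemma constV (K : fieldType) (c : K) : c^-1%:P%:F = c%:P%:F^-1.
Proof. exact: (fmorphV (@tofrac _ \o @polyC K)). Qed.

Lemma divf_common (K : fieldType) (c x y : K) : c != 0 -> x / y = x / c / (y / c).
Proof. by move=> c0; rewrite -mulf_div divff ?mulr1// invr_eq0. Qed.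

Lemma mulf_divK (K : fieldType) (c x y : K) : c != 0 -> x * c * (y / c) = x * y.
Proof. by move=> c0; field. Qed.

Lemma mulf_divMr (K : fieldType) (c x y : K) : c != 0 -> x * c / (y * c) = x / y.
Proof. by move=> c0; rewrite -mulf_div divff ?mulr1. Qed.

Lemma divf_trans (K : fieldType) (x c y : K) : y != 0 -> x / c = x / y * (y / c).
Proof. by move=> y0; rewrite mulrA divfK. Qed.

Lemma divf_divf (K : fieldType) (x y u v : K) : u != 0 -> v != 0 ->
  x / y = u / v * (x / u / (y / v)).
Proof.
move=> u0 v0; have [->|y0] := eqVneq y 0; last by field; apply/and3P.
by rewrite mul0r invr0 !mulr0.
Qed.

Lemma inv_1Dsqr (K : fieldType) (x : K) : x != 0 -> 1 + x ^+ 2 != 0 ->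
  (1 + x ^+ 2)^-1 = x^-1 ^+ 2 / (1 + x^-1 ^+ 2).
Proof. by move=> x0 x1; field; rewrite x0 addrC x1. Qed.

Lemma XsubC_frac_neq0 (K : fieldType) (c : K) : ('X - c%:P)%:F != 0.
Proof. by rewrite tofrac_eq0 polyXsubC_eq0. Qed.

Definition is_lift (Rc F : fieldType) (phi : {rmorphism Rc -> F}) (zeta : F -> option RR)
    (j : M {fraction {poly Rc}} -> M {fraction {poly F}}) :=
  [/\ Mcontinuous j,
      (forall xi x, sval (j xi) (ratfun_map phi x) = sval xi x)
    & (forall xi c, sval (j xi) c%:P%:F = zeta c)].

Section Lift.
Variables (Rc : rcfType) (F : fieldType) (phi : {rmorphism Rc -> F}).
Variables (zeta : F -> option RR) (j : M {fraction {poly Rc}} -> M {fraction {poly F}}).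
Hypothesis jP : is_lift phi zeta j.
Variables (lam : Rc -> option RR) (lamP : is_Rplace lam) (a : Rc).

Let t : {fraction {poly F}} := ('X - (phi a)%:P)%:F.

Let t_neq0 : t != 0. Proof. exact: XsubC_frac_neq0. Qed.

Let tE n r : r != 0 ->
  t ^+ n / (phi r)%:P%:F = ratfun_map phi ((('X - a%:P) ^+ n)%:F / r%:P%:F).
Proof.
move=> r0; rewrite ratfun_map_frac ?polyC_eq0// rmorphXn rmorphB/= map_polyX !map_polyC/=.
by rewrite tofracXn.
Qed.

(** The quotient comes from R(y), so compatibility with restriction reduces its value to
    specialising y to [b]. *)
Lemma lift_pow_div (b r : Rc) n : r != 0 ->
  sval (j (Mplace_at lamP b)) (t ^+ n / (phi r)%:P%:F) = lam ((b - a) ^+ n / r).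
Proof.
move=> r0; rewrite tE//; case: jP => _ -> _; rewrite /= (place_atE _ (c := (b - a) ^+ n / r))//.
exists (('X - a%:P) ^+ n), r%:P.
by rewrite hornerC horner_exp hornerXsubC r0.
Qed.

(* The place at [a] is a limit of places at [b != a]; there [t ^+ n] is a nonzero
   element of [Rc] up to a unit, hence infinitely larger than [d]. *)
Lemma lift_infinitesimal (d : F) n : d != 0 -> (0 < n)%N ->
  (forall r, r != 0 -> zeta (d / phi r) = Some 0) ->
  sval (j (Mplace_at lamP a)) (d%:P%:F / t ^+ n) = Some 0.
Proof.
move=> d0 n0 dinf; case: (jP) => jc _ jz.
set za := sval _; have zaP : is_Rplace za := svalP _.
pose w := t ^+ n / d%:P%:F.
have w0 : w != 0.
  exact: (mulf_neq0 (expf_neq0 n t_neq0) (invr_neq0 (const_neq0 d0))).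
rewrite -[_ / t ^+ n]invf_div -/w.
case zw: (za w) => [v|]; last exact: place_infV.
(* The test function 1 / (1 + w^2) is positive where [w] is finite and 0 where [w] is infinite.
   Continuity carries its positivity to some place at [b] distinct from [a], where [w] is
   infinite. *)
exfalso; have v1 : 0 < 1 + v ^+ 2 by rewrite ltr_pwDl ?sqr_ge0.
have zu : za (1 + w ^+ 2)^-1 = Some (1 + v ^+ 2)^-1.
  apply: placeV => //; last by rewrite gt_eqF.
  by apply: placeD (place1 zaP) _ => //; apply: placeX.
have [|h ah hP] := @Mcontinuous_Hp _ _ j (Mplace_at lamP a) (1 + w ^+ 2)^-1 jc.
  by exists (1 + v ^+ 2)^-1; rewrite invr_gt0.
have [b ba bh] := place_at_dense lamP a ah.
have [e [+ e0]] := hP _ bh; set zb := sval _; have zbP : is_Rplace zb := svalP _.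
have ba0 : (b - a) ^+ n != 0 by rewrite expf_neq0// subr_eq0.
have zt : zb (t ^+ n / (phi ((b - a) ^+ n))%:P%:F) = Some 1.
  by rewrite /zb lift_pow_div// divff// place1.
have zd : zb (d%:P%:F / (phi ((b - a) ^+ n))%:P%:F) = Some 0.
  by rewrite -(dinf _ ba0) -(jz (Mplace_at lamP b)) constM constV.
have wV : zb w^-1 = Some 0.
  rewrite invf_div -[0](mul0r 1^-1).
  have rF0 : (phi ((b - a) ^+ n))%:P%:F != 0.
    by apply: const_neq0; rewrite fmorph_eq0.
  by rewrite (divf_common _ _ rF0); apply: (place_div zbP zd zt (oner_neq0 _)).
have zbu : zb (1 + w ^+ 2)^-1 = Some 0.
  rewrite (inv_1Dsqr w0 (place_1Dsqr zbP w)).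
  have wV2 := placeX zbP 2 wV; have := placeD zbP (place1 zbP) wV2.
  rewrite expr0n addr0 in wV2 * => w1.
  by have := place_div zbP wV2 w1 (oner_neq0 _); rewrite mul0r.
by rewrite zbu => -[e00]; move: e0; rewrite -e00 ltxx.
Qed.

End Lift.

(** * Agreement of two lifts *)

Section TwoLifts.
Variables (Rc : rcfType) (F : fieldType) (phi : {rmorphism Rc -> F}).
Variables (zeta : F -> option RR) (j1 j2 : M {fraction {poly Rc}} -> M {fraction {poly F}}).
Hypotheses (j1P : is_lift phi zeta j1) (j2P : is_lift phi zeta j2).

Section AtPoint.
Variables (lam : Rc -> option RR) (lamP : is_Rplace lam) (a : Rc).

Let t : {fraction {poly F}} := ('X - (phi a)%:P)%:F.
Let z1 := sval (j1 (Mplace_at lamP a)).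
Let z2 := sval (j2 (Mplace_at lamP a)).
Let z1P : is_Rplace z1 := svalP _.
Let z2P : is_Rplace z2 := svalP _.

Lemma lifts_monomial c n : c != 0 -> (0 < n)%N ->
  (z1 (c%:P%:F * t ^+ n) = Some 0 /\ z2 (c%:P%:F * t ^+ n) = Some 0) \/
  (z1 (c%:P%:F * t ^+ n) = None /\ z2 (c%:P%:F * t ^+ n) = None).
Proof.
move=> c0 n0.
have ct0 : c%:P%:F * t ^+ n != 0.
  exact: mulf_neq0 (const_neq0 c0) (expf_neq0 n (XsubC_frac_neq0 _)).
(* The criterion involves only [zeta], so it selects the same case for both lifts. *)
have [[r [r0 [v cr]]]|noR] := pselect (exists r, r != 0 /\ exists v, zeta (c * phi r) = Some v).
  left.
  have lift0 j (jP : is_lift phi zeta j) :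
      sval (j (Mplace_at lamP a)) (c%:P%:F * t ^+ n) = Some 0.
    set z := sval _; have zP : is_Rplace z := svalP _.
    have := lift_pow_div jP lamP a a n r0; rewrite subrr expr0n eqn0Ngt n0 mul0r place0// => zt.
    have zc : z (c * phi r)%:P%:F = Some v by case: jP => _ _ jz; rewrite /z jz.
    have rF0 : (phi r)%:P%:F != 0 by apply: const_neq0; rewrite fmorph_eq0.
    have := placeM zP zc zt; rewrite mulr0 => <-; congr (z _).
    by rewrite constM mulf_divK.
  by split; apply: lift0.
right.
(* Here [zeta] is a bare function; the rule for inverses comes from the place given by [j1], which
   agrees with [zeta] on constants. *)
have cinf r : r != 0 -> zeta (c^-1 / phi r) = Some 0.
  move=> r0; rewrite -invfM; case: j1P => _ _ j1z.
  rewrite -(j1z (Mplace_at lamP a)) constV.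
  apply: (place_infV z1P); rewrite /z1 j1z.
  case E: (zeta _) => [v|//]; exfalso; apply: noR; exists r; split=> //.
  by exists v.
have liftN j (jP : is_lift phi zeta j) :
    sval (j (Mplace_at lamP a)) (c%:P%:F * t ^+ n) = None.
  have := lift_infinitesimal jP lamP a (d := c^-1) _ n0 cinf.
  rewrite invr_eq0 c0 => /(_ isT).
  rewrite constV -invfM => /(place_V0 (svalP _)).
  by rewrite invrK; apply; rewrite invr_neq0.
by split; apply: liftN.
Qed.

(* By [lifts_monomial] the terms of [p], expanded at [a], have pairwise distinct
   values, ordered in the same way by both places. *)
Lemma lifts_leading (p : {poly F}) : p != 0 -> exists c m, [/\ c != 0,
  z1 ((p \Po ('X - (phi a)%:P))%:F / (c%:P%:F * t ^+ m)) = Some 1 &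
  z2 ((p \Po ('X - (phi a)%:P))%:F / (c%:P%:F * t ^+ m)) = Some 1].
Proof.
have tn0 n : t ^+ n != 0 by exact: expf_neq0 n (XsubC_frac_neq0 _).
elim/poly_ind: p => [|p c0 IH]; first by rewrite eqxx.
rewrite comp_polyD comp_polyM comp_polyX comp_polyC tofracD tofracM -/t.
have [->|p0] := eqVneq p 0.
  rewrite mul0r add0r polyC_eq0 => c00; exists c0, 0%N.
  rewrite comp_poly0 tofrac0 mul0r add0r expr0 mulr1 divff ?const_neq0//.
  by split; [|apply: place1 z1P|apply: place1 z2P].
have [c [m [c_neq0 p1 p2]]] := IH p0; move=> _.
set P := (p \Po _)%:F in p1 p2 *.
have cF0 := const_neq0 c_neq0.
have PE : P * t / (c%:P%:F * t ^+ m.+1) = P / (c%:P%:F * t ^+ m).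
  by rewrite exprSr mulrA; apply: mulf_divMr (XsubC_frac_neq0 _).
have [->|c00] := eqVneq c0 0.
  by exists c, m.+1; rewrite tofrac0 addr0 PE.
have c0F0 := const_neq0 c00.
have ratio : c%:P%:F * t ^+ m.+1 / c0%:P%:F = (c / c0)%:P%:F * t ^+ m.+1.
  by rewrite constM constV mulrAC.
(* The dominant monomial of the part divisible by [t] is compared with the constant term: if the
   ratio has value 0 the constant dominates, otherwise the monomial does. *)
have [[h1 h2]|[h1 h2]] := lifts_monomial (mulf_neq0 c_neq0 (invr_neq0 c00)) (ltn0Sn m).
  exists c0, 0%N; rewrite expr0 mulr1 mulrDl divff//.
  rewrite (divf_trans (P * t) c0%:P%:F (mulf_neq0 cF0 (tn0 m.+1))) PE ratio; split => //.
    by have := placeD z1P (placeM z1P p1 h1) (place1 z1P); rewrite mulr0 add0r.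
  by have := placeD z2P (placeM z2P p2 h2) (place1 z2P); rewrite mulr0 add0r.
exists c, m.+1; rewrite mulrDl PE -[c0%:P%:F / _]invf_div ratio; split => //.
  by have := placeD z1P p1 (place_infV z1P h1); rewrite addr0.
by have := placeD z2P p2 (place_infV z2P h2); rewrite addr0.
Qed.

(** Up to a factor of value 1 at both places, a fraction is the quotient of two monomials in [t].
    This quotient is a monomial of positive degree, the inverse of one, or a constant, and both
    places agree on each. *)
Lemma lifts_eq_at x : z1 x = z2 x.
Proof.
have tn0 n : t ^+ n != 0 by exact: expf_neq0 n (XsubC_frac_neq0 _).
have shiftK (p : {poly F}) : p = (p \Po ('X + (phi a)%:P)) \Po ('X - (phi a)%:P).
  by rewrite -comp_polyA comp_polyD comp_polyX comp_polyC subrK comp_polyXr.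
have [n [d [d0 ->]]] := fracP x.
have [->|n0] := eqVneq n 0; first by rewrite tofrac0 mul0r !place0.
have shift0 (p : {poly F}) : p != 0 -> p \Po ('X + (phi a)%:P) != 0.
  by apply: contraNneq => p0; rewrite (shiftK p) p0 comp_poly0.
have [c [k [c0 n1 n2]]] := lifts_leading (shift0 _ n0).
have [e [l [e0 d1 d2]]] := lifts_leading (shift0 _ d0).
rewrite -!shiftK in n1 n2 d1 d2.
rewrite (divf_divf _ _ (mulf_neq0 (const_neq0 c0) (tn0 k)) (mulf_neq0 (const_neq0 e0) (tn0 l))).
have u1 := place_div z1P n1 d1 (oner_neq0 _); rewrite divr1 in u1.
have u2 := place_div z2P n2 d2 (oner_neq0 _); rewrite divr1 in u2.
rewrite (place_mul_unit z1P _ u1) (place_mul_unit z2P _ u2).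
have ratio (c' e' : F) k' l' : (l' <= k')%N -> c'%:P%:F * t ^+ k' / (e'%:P%:F * t ^+ l') =
    (c' / e')%:P%:F * t ^+ (k' - l').
  move=> lk; rewrite constM constV -{1}(subnK lk) exprD mulrA.
  rewrite mulf_divMr; first by rewrite mulrAC.
  exact: tn0.
case: (ltngtP k l) => kl.
- rewrite -[_ / _]invf_div ratio 1?ltnW//.
  set y := _ * _; have y0 : y != 0.
    exact: mulf_neq0 (const_neq0 (mulf_neq0 e0 (invr_neq0 c0))) (tn0 _).
  have lk : (0 < l - k)%N by rewrite subn_gt0.
  have [[h1 h2]|[h1 h2]] := lifts_monomial (mulf_neq0 e0 (invr_neq0 c0)) lk.
    by rewrite (place_V0 z1P y0 h1) (place_V0 z2P y0 h2).
  by rewrite (place_infV z1P h1) (place_infV z2P h2).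
- rewrite ratio 1?ltnW//.
  have lk : (0 < k - l)%N by rewrite subn_gt0.
  by have [[-> ->]|[-> ->]] := lifts_monomial (mulf_neq0 c0 (invr_neq0 e0)) lk.
- rewrite kl ratio// subnn expr0 mulr1.
  by case: j1P => _ _ j1z; case: j2P => _ _ j2z; rewrite /z1 /z2 j1z j2z.
Qed.

End AtPoint.

Lemma lifts_eq xi x : sval (j1 xi) x = sval (j2 xi) x.
Proof.
(* The place of R needed to form places at points is the trace of [xi] on the constants. *)
have const_place : is_Rplace (sval xi \o (@tofrac _ \o @polyC Rc)).
  exact: place_comp (svalP xi).
(* Both conditions would hold throughout a neighbourhood of [xi], hence at some place at a point,
   where the two lifts coincide. *)
have no_sep y : Hp y (j1 xi) -> ~ Hp (- y) (j2 xi).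
  move=> y1 y2; case: (j1P) => j1c _ _; case: (j2P) => j2c _ _.
  have [h1 h1x h1P] := Mcontinuous_Hp j1c y1.
  have [h2 h2x h2P] := Mcontinuous_Hp j2c y2.
  have [h hx hP] := HpI h1x h2x.
  have [b _ /hP[/h1P[v1 [jv1 v10]] /h2P[v2 [jv2 v20]]]] := place_at_dense const_place 0 hx.
  move: jv2; rewrite -lifts_eq_at (placeN (svalP _) jv1) => -[v21].
  by move: v20; rewrite -v21 oppr_gt0 ltNge ltW.
have P1 := svalP (j1 xi); have P2 := svalP (j2 xi).
have fin_eq y v1 v2 : sval (j1 xi) y = Some v1 -> sval (j2 xi) y = Some v2 -> v1 = v2.
  move=> y1 y2; apply/eqP; rewrite eq_le !leNgt.
  apply/andP; split; apply/negP => /rat_between[q q1 q2].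
    apply: (no_sep (y - ratr q)).
      by exists (v1 - ratr q); rewrite subr_gt0; split=> //; apply: placeB (place_rat P1 q).
    by exists (ratr q - v2); rewrite opprB subr_gt0; split=> //; apply: placeB (place_rat P2 q) _.
  apply: (no_sep (ratr q - y)).
    by exists (ratr q - v1); rewrite subr_gt0; split=> //; apply: placeB (place_rat P1 q) _.
  by exists (v2 - ratr q); rewrite opprB subr_gt0; split=> //; apply: placeB (place_rat P2 q).
(* Infinite values are handled through 1 / (1 + x^2), which is always finite and vanishes exactly
   where [x] is infinite. *)
have sq_gt0 (v : RR) : 0 < 1 + v ^+ 2 by rewrite ltr_pwDl ?sqr_ge0.
have fin (z : _ -> option RR) v : is_Rplace z -> z x = Some v ->
    z (1 + x ^+ 2)^-1 = Some (1 + v ^+ 2)^-1.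
  move=> zP zx; apply: placeV => //; last by rewrite gt_eqF.
  by apply: placeD (place1 zP) _ => //; apply: placeX.
have inf (z : _ -> option RR) : is_Rplace z -> z x = None -> z (1 + x ^+ 2)^-1 = Some 0.
  move=> zP zx; case zs: (z (1 + x ^+ 2)) => [v|]; last exact: place_infV.
  have := zs; rewrite -[1](expr1n _ 2) => /(place_sum2sq zP)[_ [u [_ + _]]].
  by rewrite zx.
case x1: (sval (j1 xi) x) => [v1|]; case x2: (sval (j2 xi) x) => [v2|] //.
- by congr Some; apply: fin_eq x1 x2.
- have /eqP := fin_eq _ _ _ (fin _ _ P1 x1) (inf _ P2 x2).
  by rewrite invr_eq0 gt_eqF.
- have /esym/eqP := fin_eq _ _ _ (inf _ P1 x1) (fin _ _ P2 x2).
  by rewrite invr_eq0 gt_eqF.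
Qed.

End TwoLifts.

(** * Restriction from the real closures *)

Definition restrict (K L : fieldType) (s : {rmorphism K -> L}) (z : M L) : M K :=
  exist _ (sval z \o s) (place_comp s (svalP z)).

(** The preimage of the subbasic set of [b] is the subbasic set of [s b]. *)
Lemma restrict_continuous (K L : fieldType) (s : {rmorphism K -> L}) :
  Mcontinuous (restrict s).
Proof.
move=> U Uo z /Uo[l [zl lU]]; exists (map s l); split => [_ /mapP[b bl ->]|xi xl].
  exact: zl b bl.
by apply: lU => b bl; apply: xl (s b) (map_f s bl).
Qed.

(* Squares have nonnegative value, so a place of a real closed field is the one
   induced by its order. *)
Lemma place_real_closure (F : fieldType) (P : F -> Prop) (zeta : M F)
    (R' : rcfType) (s : {rmorphism F -> R'}) (z : R' -> option RR) :
  induces P (sval zeta) -> is_real_closure P s -> is_Rplace z ->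
  forall c, z (s c) = sval zeta c.
Proof.
move=> Pzeta [Ps _] zP c; have zetaP := svalP zeta.
have real x v : sval zeta x = Some v -> z (s x) = Some v.
  move=> /Pzeta xv; apply: (place_order_eq zP) => q r qv vr.
  have [/Ps + /Ps] := xv q r qv vr.
  by rewrite !rmorphB/= !fmorph_rat !subr_ge0 => -> ->.
case zc: (sval zeta c) => [v|]; first exact: real.
have c0 := place_inf_neq0 zetaP zc.
have := real _ _ (place_infV zetaP zc); rewrite fmorphV => /(place_V0 zP).
by rewrite invrK invr_eq0 fmorph_eq0; apply.
Qed.

(** On constants, [i xi] is a place of the real closed field [R']; the order determines it, so on
    [F] it gives [zeta]. *)
Lemma restrict_lift (Rc R' : rcfType) (F : fieldType) (phi : {rmorphism Rc -> F})
    (P : F -> Prop) (zeta : M F) (s : {rmorphism F -> R'})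
    (i : M {fraction {poly Rc}} -> M {fraction {poly R'}}) :
  induces P (sval zeta) -> is_real_closure P s -> Mcontinuous i ->
  (forall xi, sval (i xi) \o frac_map (map_poly (s \o phi)) = sval xi) ->
  is_lift phi (sval zeta) (fun xi => restrict (ratfun_map s) (i xi)).
Proof.
move=> Pzeta sP ic ir; split => [U Uo|xi x|xi c] /=.
- exact: ic _ (restrict_continuous Uo).
- by rewrite -(ir xi) /= -ratfun_map_comp.
- rewrite ratfun_map_tofrac map_polyC/=.
  exact: (place_real_closure Pzeta sP (place_comp (@tofrac _ \o @polyC R') (svalP (i xi)))).
Qed.

Theorem theorem5p2 (Rc : rcfType) (F : fieldType) (phi : {rmorphism Rc -> F})
  (Freal : formally_real F)
  (P1 P2 : F -> Prop) (HP1 : is_ordering P1) (HP2 : is_ordering P2)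
  (Hsame : exists zeta : M F, induces P1 (sval zeta) /\ induces P2 (sval zeta))
  (R1 R2 : rcfType) (s1 : {rmorphism F -> R1}) (s2 : {rmorphism F -> R2})
  (Hs1 : is_real_closure P1 s1) (Hs2 : is_real_closure P2 s2)
  (i1 : M {fraction {poly Rc}} -> M {fraction {poly R1}})
  (i2 : M {fraction {poly Rc}} -> M {fraction {poly R2}})
  (Hi1c : Mcontinuous i1) (Hi1i : injective i1)
  (Hi1r : forall xi, sval (i1 xi) \o frac_map (map_poly (s1 \o phi)) = sval xi)
  (Hi2c : Mcontinuous i2) (Hi2i : injective i2)
  (Hi2r : forall xi, sval (i2 xi) \o frac_map (map_poly (s2 \o phi)) = sval xi) :
  forall xi : M {fraction {poly Rc}},
    sval (i1 xi) \o frac_map (map_poly s1) = sval (i2 xi) \o frac_map (map_poly s2).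
Proof.
move=> xi; case: Hsame => zeta [zeta1 zeta2].
apply/funext => x.
exact: (lifts_eq (restrict_lift zeta1 Hs1 Hi1c Hi1r) (restrict_lift zeta2 Hs2 Hi2c Hi2r) xi x).
Qed.
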